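(* The following three identities hold: $$\sum_{k=0}^\infty\frac{(6k-1)(42k-1)\binom{6k}{3k}}{4096^k}=\frac{32}{27}\sqrt3,$$ $$\sum_{k=0}^\infty\frac{(42k+5)\binom{6k}{3k}}{(6k-5)\,4096^k}=-\frac{4}{9}\sqrt3,$$ and $$\sum_{k=0}^\infty\frac{(252k^2-120k+5)\binom{6k}{3k}}{(2k-1)(6k-1)(6k-5)\,4096^k}=-\frac{\sqrt3}{2}.$$
   Context: Here $\binom{6k}{3k}$ is the usual binomial coefficient; all series are convergent series of real numbers. *)

(* Defs.v *)
From Stdlib Require Export Reals.
From Coquelicot Require Export Coquelicot.

(* Coquelicot shadows [C] with the complex numbers, hence the qualified name
   for the binomial coefficient. *)
Definition binom63 (k : nat) : R := Binomial.C (6 * k) (3 * k).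

(* Main.v *)
Require Import Defs.
From Stdlib Require Import Reals Lra Lia.
From Coquelicot Require Import Coquelicot.
Open Scope R_scope.

(** The factor [binom63 k / 4096 ^ k] is [a (3 k)], where
    [a n = binom(2n, n) / 16 ^ n], and the central binomial series gives
    [sum_n a n = (1 - 4/16)^(-1/2) = 2 / sqrt 3].  So each series samples the
    latter one at every third index, with rational weights.

    Consecutive values of [a] have a rational quotient
    ([scaled_central_succ]).  Hence modulo telescoping differences
    [G (k+1) - G k], with [G k = P k * a (3 k)] and [P] rational, a weighted
    term can be compared with the full block
    [a (3k) + a (3k+1) + a (3k+2)].  For the three weights of the theorem the
    term equals [c] times the block plus such a difference, with [c] equal to
    [16/9], [-2/3] and [-3/4]; the blocks add up to the whole central binomial
    series, [G 0 = 0] and [G k] tends to [0], so the sum is [c * 2 / sqrt 3]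
    ([is_series_by_blocks]).  The functions [P] were found by linear algebra
    over the rationals, taking for the denominator of [P] that of the weight:
    replacing [k] by [k+1] in [6k-5], [2k-1], [6k-1] gives [6k+1], [2k+1],
    [6k+5], which are cancelled by the numerator of [a (3k+3) / a (3k)].

    The central binomial series itself is evaluated through the differential
    equation [(1 - 4x) f' = 2 f], which forces [f x * sqrt (1 - 4x)] to be
    constant ([is_pseries_central]). *)

(** * The central binomial series *)

Definition central (n : nat) : R := Binomial.C (2 * n) n.

Lemma central_0 : central 0 = 1.
Proof. unfold central, Binomial.C; simpl; field. Qed.

Lemma central_succ (n : nat) :
  central (S n) = 2 * (2 * INR n + 1) / (INR n + 1) * central n.
Proof.
  unfold central, Binomial.C.
  replace (2 * S n - S n)%nat with (S n) by lia.
  replace (2 * n - n)%nat with n by lia.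
  replace (2 * S n)%nat with (S (S (2 * n))) by lia.
  rewrite !fact_simpl, !mult_INR, !S_INR, mult_INR.
  pose proof (INR_fact_neq_0 n).
  pose proof (pos_INR n).
  simpl (INR 2).
  field; lra.
Qed.

Lemma central_bounds (n : nat) : 0 <= central n <= 4 ^ n.
Proof.
  induction n as [|n IH].
  - rewrite central_0; simpl; lra.
  - rewrite central_succ.
    pose proof (pos_INR n) as Hn.
    assert (Hr : 0 <= 2 * (2 * INR n + 1) / (INR n + 1) <= 4).
    { split.
      - apply Rdiv_le_0_compat; lra.
      - apply Rle_div_l; lra. }
    simpl pow; split.
    + apply Rmult_le_pos; lra.
    + apply Rmult_le_compat; lra.
Qed.

Lemma CV_radius_central : Rbar_le (1 / 4) (CV_radius central).
Proof.
  apply (proj1 (CV_radius_bounded central)).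
  exists 1; intros n.
  pose proof (central_bounds n) as Hb.
  replace ((1 / 4) ^ n) with (/ 4 ^ n)
    by (rewrite <- pow_inv; f_equal; field).
  assert (H4 : 0 < 4 ^ n) by (apply pow_lt; lra).
  rewrite Rabs_pos_eq.
  - apply Rle_div_l; lra.
  - apply Rmult_le_pos; [lra | apply Rlt_le, Rinv_0_lt_compat, H4].
Qed.

Lemma in_disk_central (x : R) :
  Rabs x < 1 / 4 -> Rbar_lt (Rabs x) (CV_radius central).
Proof.
  intros Hx; eapply Rbar_lt_le_trans; [|exact CV_radius_central]; exact Hx.
Qed.

(** The recurrence for [central], in the form
    [(n+1) c_(n+1) = 4 n c_n + 2 c_n], read coefficientwise. *)
Lemma central_ode (x : R) : Rabs x < 1 / 4 ->
  (1 - 4 * x) * PSeries (PS_derive central) x = 2 * PSeries central x.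
Proof.
  intros Hx; pose proof (in_disk_central x Hx) as Hd.
  assert (Hc : ex_pseries central x) by now apply CV_radius_inside.
  assert (Hc' : ex_pseries (PS_derive central) x)
    by (apply CV_radius_inside; now rewrite CV_radius_derive).
  assert (H : PSeries (PS_derive central) x =
    PSeries (PS_plus (PS_scal 4 (PS_incr_1 (PS_derive central)))
                     (PS_scal 2 central)) x).
  { apply PSeries_ext; intros n.
    change (INR (S n) * central (S n) =
      4 * PS_incr_1 (PS_derive central) n + 2 * central n).
    rewrite S_INR, central_succ.
    destruct n as [|n]; unfold PS_incr_1, PS_derive, zero; simpl Nat.add.
    - rewrite central_0; simpl; field.
    - pose proof (pos_INR n); rewrite S_INR; field; lra. }
  rewrite PSeries_plus, !PSeries_scal, PSeries_incr_1 in H.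
  - lra.
  - apply ex_pseries_scal; [apply Rmult_comm | now apply ex_pseries_incr_1].
  - apply ex_pseries_scal; [apply Rmult_comm | assumption].
Qed.

Lemma is_pseries_central (x : R) :
  Rabs x < 1 / 4 -> is_pseries central x (/ sqrt (1 - 4 * x)).
Proof.
  intros Hx.
  set (h := fun y => PSeries central y * sqrt (1 - 4 * y)).
  assert (Hh : forall y, Rabs y < 1 / 4 -> is_derive h y 0).
  { intros y Hy; pose proof Hy as Hy'; apply Rabs_def2 in Hy'.
    assert (Hs : 0 < sqrt (1 - 4 * y)) by (apply sqrt_lt_R0; lra).
    assert (Hs2 : sqrt (1 - 4 * y) * sqrt (1 - 4 * y) = 1 - 4 * y)
      by (apply sqrt_sqrt; lra).
    pose proof (is_derive_PSeries central y (in_disk_central y Hy)) as Hf.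
    assert (Hg : is_derive (fun y => sqrt (1 - 4 * y)) y
                   (- 2 / sqrt (1 - 4 * y))).
    { auto_derive; [lra|].
      unfold Rminus in Hs |- *; field; lra. }
    pose proof (is_derive_mult _ _ y _ _ Hf Hg Rmult_comm) as Hm.
    replace 0 with
      (plus (mult (PSeries (PS_derive central) y) (sqrt (1 - 4 * y)))
            (mult (PSeries central y) (- 2 / sqrt (1 - 4 * y)))).
    - exact Hm.
    - unfold plus, mult; simpl.
      pose proof (central_ode y Hy) as Hode; rewrite <- Hs2 in Hode.
      apply Rmult_eq_reg_r with (sqrt (1 - 4 * y)); [|lra].
      field_simplify; [|lra].
      simpl pow; rewrite Rmult_1_r; lra. }
  assert (Hseg : forall y, Rmin 0 x <= y <= Rmax 0 x -> Rabs y < 1 / 4).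
  { intros y Hy; apply Rabs_def2 in Hx; apply Rabs_def1;
      revert Hy; unfold Rmin, Rmax; destruct (Rle_dec 0 x); lra. }
  destruct (MVT_gen h 0 x (fun _ => 0)) as [y [_ Heq]].
  { intros y Hy; apply Hh, Hseg; lra. }
  { intros y Hy; apply derivable_continuous_pt.
    exists 0; apply is_derive_Reals, Hh, Hseg, Hy. }
  assert (Hval : h x = 1).
  { assert (h 0 = 1); [|lra].
    unfold h; rewrite PSeries_0, central_0.
    replace (1 - 4 * 0) with 1 by ring; rewrite sqrt_1; ring. }
  assert (Hs : 0 < sqrt (1 - 4 * x))
    by (apply sqrt_lt_R0; apply Rabs_def2 in Hx; lra).
  replace (/ sqrt (1 - 4 * x)) with (PSeries central x).
  - apply PSeries_correct, CV_radius_inside, in_disk_central, Hx.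
  - unfold h in Hval.
    apply Rmult_eq_reg_r with (sqrt (1 - 4 * x)); [|lra].
    rewrite Hval; field; lra.
Qed.

(** * Sampling the series at every third index *)

Definition scaled_central (n : nat) : R := central n / 16 ^ n.

Lemma scaled_central_succ (n : nat) :
  scaled_central (S n) =
  (2 * INR n + 1) / (8 * (INR n + 1)) * scaled_central n.
Proof.
  unfold scaled_central; rewrite central_succ; simpl pow.
  pose proof (pos_INR n).
  assert (16 ^ n <> 0) by (apply pow_nonzero; lra).
  field; lra.
Qed.

Lemma scaled_central_bounds (n : nat) : 0 <= scaled_central n <= (1 / 4) ^ n.
Proof.
  unfold scaled_central; pose proof (central_bounds n).
  assert (H16 : 0 < 16 ^ n) by (apply pow_lt; lra).
  split.
  - apply Rdiv_le_0_compat; lra.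
  - apply Rle_div_l; [lra|].
    rewrite <- Rpow_mult_distr.
    replace (1 / 4 * 16) with 4 by field; lra.
Qed.

Lemma is_series_scaled_central : is_series scaled_central (2 / sqrt 3).
Proof.
  assert (Hx : Rabs (/ 16) < 1 / 4) by (rewrite Rabs_pos_eq; lra).
  pose proof (is_pseries_central (/ 16) Hx) as H.
  replace (2 / sqrt 3) with (/ sqrt (1 - 4 * / 16)).
  - apply is_pseries_R in H.
    revert H; apply is_series_ext; intros n.
    unfold scaled_central; now rewrite pow_inv.
  - replace (1 - 4 * / 16) with (3 / (2 * 2)) by field.
    rewrite sqrt_div, sqrt_square by lra.
    assert (0 < sqrt 3) by (apply sqrt_lt_R0; lra).
    field; lra.
Qed.

(** Since [k <= 2 ^ k], the product is at most [M * 8 ^ k / 64 ^ k]. *)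
Lemma cubic_mul_scaled_central_lim (P : nat -> R) (M : R) :
  (forall k, Rabs (P k) <= M * INR k ^ 3) ->
  is_lim_seq (fun k => P k * scaled_central (3 * k)) 0.
Proof.
  intros HP.
  assert (HM : 0 <= M).
  { specialize (HP 1%nat); pose proof (Rabs_pos (P 1%nat)); simpl in HP; lra. }
  apply is_lim_seq_abs_0.
  apply is_lim_seq_le_le with (u := fun _ => 0) (w := fun k => M * (1 / 8) ^ k).
  - intros k; split; [apply Rabs_pos|].
    rewrite Rabs_mult, (Rabs_pos_eq (scaled_central _))
      by apply scaled_central_bounds.
    assert (Hk : INR k <= 2 ^ k).
    { induction k as [|k IH]; [simpl; lra|].
      rewrite S_INR; simpl pow.
      assert (1 <= 2 ^ k) by (apply pow_R1_Rle; lra); lra. }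
    assert (Hk3 : INR k ^ 3 <= 8 ^ k).
    { replace (8 ^ k) with ((2 ^ k) ^ 3)
        by (rewrite <- pow_mult, Nat.mul_comm, pow_mult; f_equal; ring).
      apply pow_incr; split; [apply pos_INR | exact Hk]. }
    apply Rle_trans with (M * 8 ^ k * (1 / 4) ^ (3 * k)).
    + apply Rmult_le_compat; try apply Rabs_pos; try apply scaled_central_bounds.
      eapply Rle_trans; [apply HP|]; now apply Rmult_le_compat_l.
    + right; rewrite pow_mult, Rmult_assoc, <- Rpow_mult_distr.
      f_equal; f_equal; field.
  - apply is_lim_seq_const.
  - replace (Finite 0) with (Rbar_mult M 0) by (simpl; f_equal; ring).
    apply is_lim_seq_scal_l, is_lim_seq_geom; rewrite Rabs_pos_eq; lra.
Qed.

(** The partial sum of [t] up to [N] is [c] times the partial sum of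
    [scaled_central] up to [3 N + 2], plus the boundary term of the
    telescoping at [N + 1]; the one at [0] vanishes because the bound on [P]
    forces [P 0 = 0]. *)
Lemma is_series_by_blocks (t P : nat -> R) (c M : R) :
  (forall k, Rabs (P k) <= M * INR k ^ 3) ->
  (forall k, t k =
     c * (scaled_central (3 * k) + scaled_central (S (3 * k))
          + scaled_central (S (S (3 * k))))
     + (P (S k) * scaled_central (3 * S k) - P k * scaled_central (3 * k))) ->
  is_series t (c * (2 / sqrt 3)).
Proof.
  intros HP Ht.
  assert (HP0 : P 0%nat = 0).
  { specialize (HP 0%nat); simpl in HP.
    apply Rabs_eq_0; pose proof (Rabs_pos (P 0%nat)); lra. }
  assert (HS : forall (u : nat -> R) n, sum_n u (S n) = sum_n u n + u (S n) :> R)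
    by (intros; rewrite sum_Sn; reflexivity).
  assert (Hsum : forall N, sum_n t N =
    c * sum_n scaled_central (3 * N + 2)
    + P (S N) * scaled_central (3 * S N) :> R).
  { intros N; induction N as [|N IH].
    - change (3 * 0 + 2)%nat with 2%nat.
      rewrite !HS, !sum_O, Ht, HP0.
      change (3 * 0)%nat with 0%nat; ring.
    - rewrite HS, IH, (Ht (S N)).
      replace (3 * S N + 2)%nat with (S (S (S (3 * N + 2)))) by lia.
      rewrite !HS.
      replace (S (3 * N + 2)) with (3 * S N)%nat by lia.
      ring. }
  change (is_lim_seq (sum_n t) (c * (2 / sqrt 3))).
  apply is_lim_seq_ext with (1 := fun N => eq_sym (Hsum N)).
  replace (Finite (c * (2 / sqrt 3))) with (Finite (c * (2 / sqrt 3) + 0))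
    by (f_equal; ring).
  apply is_lim_seq_plus'.
  - apply (is_lim_seq_scal_l _ c (2 / sqrt 3)).
    apply (is_lim_seq_subseq (sum_n scaled_central) _ (fun N => 3 * N + 2)%nat).
    + apply eventually_subseq; intros; lia.
    + exact is_series_scaled_central.
  - apply (is_lim_seq_incr_1 (fun k => P k * scaled_central (3 * k))).
    now apply cubic_mul_scaled_central_lim with M.
Qed.

(** * The three weights *)

Lemma binom63_scaled_central (k : nat) :
  binom63 k = scaled_central (3 * k) * 4096 ^ k.
Proof.
  unfold binom63, scaled_central, central.
  replace (2 * (3 * k))%nat with (6 * k)%nat by lia.
  rewrite pow_mult.
  replace (16 ^ 3) with 4096 by ring.
  field; apply pow_nonzero; lra.
Qed.

Lemma scaled_central_block (k : nat) :
  scaled_central (S (3 * k)) =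
    (6 * INR k + 1) / (8 * (3 * INR k + 1)) * scaled_central (3 * k)
  /\ scaled_central (S (S (3 * k))) =
    (6 * INR k + 1) * (6 * INR k + 3)
      / (64 * (3 * INR k + 1) * (3 * INR k + 2)) * scaled_central (3 * k)
  /\ scaled_central (3 * S k) =
    (6 * INR k + 1) * (6 * INR k + 3) * (6 * INR k + 5)
      / (512 * (3 * INR k + 1) * (3 * INR k + 2) * (3 * INR k + 3))
      * scaled_central (3 * k).
Proof.
  replace (3 * S k)%nat with (S (S (S (3 * k)))) by lia.
  rewrite !scaled_central_succ, !S_INR, mult_INR.
  pose proof (pos_INR k).
  simpl (INR 3).
  repeat split; field; lra.
Qed.

Lemma one_le_Rabs_IZR (z : Z) : z <> 0%Z -> 1 <= Rabs (IZR z).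
Proof. intros Hz; rewrite <- abs_IZR; apply IZR_le; lia. Qed.

(** The weights have no pole at an integer, and stay away from their poles,
    since each denominator is the value of an integer that is odd or prime
    to [6]. *)
Lemma weight_denominators (k : nat) :
  1 <= Rabs (2 * INR k - 1) /\ 1 <= Rabs (6 * INR k - 1)
  /\ 1 <= Rabs (6 * INR k - 5).
Proof.
  rewrite INR_IZR_INZ, <- !mult_IZR, <- !minus_IZR.
  repeat split; apply one_le_Rabs_IZR; lia.
Qed.

Lemma Rabs_ge_1_neq_0 (x : R) : 1 <= Rabs x -> x <> 0.
Proof. intros H ->; rewrite Rabs_R0 in H; lra. Qed.

Lemma Rabs_div_le (x d B : R) : 1 <= Rabs d -> Rabs x <= B -> Rabs (x / d) <= B.
Proof.
  intros Hd Hx; rewrite Rabs_div by now apply Rabs_ge_1_neq_0.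
  apply Rle_div_l; [lra|].
  pose proof (Rabs_pos x); nra.
Qed.

Lemma INR_le_cube (k : nat) :
  0 <= INR k <= INR k ^ 3 /\ 0 <= INR k ^ 2 <= INR k ^ 3.
Proof.
  destruct k as [|k]; [simpl; lra|].
  rewrite S_INR; pose proof (pos_INR k); nra.
Qed.

Theorem theorem1p2 :
  is_series
    (fun k : nat =>
       (6 * INR k - 1) * (42 * INR k - 1) * binom63 k / 4096 ^ k)
    (32 / 27 * sqrt 3)
  /\
  is_series
    (fun k : nat =>
       (42 * INR k + 5) * binom63 k / ((6 * INR k - 5) * 4096 ^ k))
    (- (4 / 9) * sqrt 3)
  /\
  is_series
    (fun k : nat =>
       (252 * INR k ^ 2 - 120 * INR k + 5) * binom63 k
         / ((2 * INR k - 1) * (6 * INR k - 1) * (6 * INR k - 5) * 4096 ^ k))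
    (- (sqrt 3 / 2)).
Proof.
  assert (H3 : 2 / sqrt 3 = 2 / 3 * sqrt 3).
  { assert (0 < sqrt 3) by (apply sqrt_lt_R0; lra).
    apply Rmult_eq_reg_r with (sqrt 3); [|lra].
    rewrite (Rmult_assoc (2 / 3)), sqrt_sqrt by lra; field; lra. }
  split; [|split].
  - replace (32 / 27 * sqrt 3) with (16 / 9 * (2 / sqrt 3)) by (rewrite H3; field).
    apply is_series_by_blocks with (M := 299)
      (P := fun k => 128 / 3 * INR k - 256 * INR k ^ 2); intros k.
    + pose proof (INR_le_cube k).
      apply Rabs_le; lra.
    + destruct (scaled_central_block k) as [-> [-> ->]].
      rewrite binom63_scaled_central, S_INR; pose proof (pos_INR k).
      assert (4096 ^ k <> 0) by (apply pow_nonzero; lra).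
      field; lra.
  - replace (- (4 / 9) * sqrt 3) with (- 2 / 3 * (2 / sqrt 3)) by (rewrite H3; field).
    apply is_series_by_blocks with (M := 48)
      (P := fun k => - 48 * INR k / (6 * INR k - 5)); intros k;
      destruct (weight_denominators k) as [_ [_ H5]].
    + apply Rabs_div_le; [exact H5|].
      pose proof (INR_le_cube k).
      apply Rabs_le; lra.
    + destruct (scaled_central_block k) as [-> [-> ->]].
      rewrite binom63_scaled_central, S_INR; pose proof (pos_INR k).
      apply Rabs_ge_1_neq_0 in H5.
      assert (4096 ^ k <> 0) by (apply pow_nonzero; lra).
      field; repeat split; lra.
  - replace (- (sqrt 3 / 2)) with (- 3 / 4 * (2 / sqrt 3)) by (rewrite H3; field).
    apply is_series_by_blocks with (M := 290)
      (P := fun k => (74 * INR k - 144 * INR k ^ 2 - 72 * INR k ^ 3)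
                     / (2 * INR k - 1) / (6 * INR k - 1) / (6 * INR k - 5));
      intros k; destruct (weight_denominators k) as [H2 [H1 H5]].
    + apply Rabs_div_le; [exact H5|].
      apply Rabs_div_le; [exact H1|].
      apply Rabs_div_le; [exact H2|].
      pose proof (INR_le_cube k).
      apply Rabs_le; lra.
    + destruct (scaled_central_block k) as [-> [-> ->]].
      rewrite binom63_scaled_central, S_INR; pose proof (pos_INR k).
      apply Rabs_ge_1_neq_0 in H1, H2, H5.
      assert (4096 ^ k <> 0) by (apply pow_nonzero; lra).
      field; repeat split; lra.
Qed.
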